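(* Let $R \ge 0$ be a real number. If $\theta=(\omega,v)\in\mathfrak{se}(3)$ satisfies $\|\theta\|_F\le R$, then $$\|\exp(\theta)\|_{\mathrm{op}} \le 1+R .$$
   Context: The Lie algebra $\mathfrak{se}(3)$ consists of the real $4\times4$ matrices $\begin{pmatrix}\Omega & v\\ 0&0\end{pmatrix}$ with $v\in\mathbb{R}^3$ and $\Omega$ a $3\times3$ skew-symmetric matrix with axial vector $\omega\in\mathbb{R}^3$ (i.e. $\Omega x=\omega\times x$ for all $x \in \mathbb{R}^3$). Such an element is identified with the pair $\theta=(\omega,v)\in\mathbb{R}^3\times\mathbb{R}^3$, and its norm is by convention the 6-vector norm $\|\theta\|_F=(\|\omega\|^2+\|v\|^2)^{1/2}$, with $\|\cdot\|$ the Euclidean norm on $\mathbb{R}^3$. $\exp(\theta)$ is the matrix exponential of the corresponding $4\times4$ matrix, and $\|A\|_{\mathrm{op}}=\sup_{\|x\|=1}\|Ax\|$ is the spectral norm of a $4\times 4$ matrix. *)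

(* Defs.v *)
From HB Require Import structures.
From mathcomp Require Import all_boot all_order all_algebra.
From mathcomp Require Import all_classical all_reals all_analysis.
From mathcomp Require Import ring.

Set Implicit Arguments.
Unset Strict Implicit.
Unset Printing Implicit Defensive.

Import Order.TTheory GRing.Theory Num.Theory.
Import numFieldNormedType.Exports.

Local Open Scope classical_set_scope.
Local Open Scope ring_scope.

(* The library's `|x| on matrices is the max norm, hence a separate l2 norm. *)
Definition norm2 (R : realType) (n : nat) (x : 'cV[R]_n) : R :=
  Num.sqrt (\sum_(i < n) x i 0 ^+ 2).

(* For n = 0 the unit sphere is empty and the value is the default sup set0. *)
Definition opnorm (R : realType) (n : nat) (A : 'M[R]_n) : R :=
  sup [set norm2 (A *m x) | x in [set x : 'cV[R]_n | norm2 x = 1]].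

(* The limit is taken in the max-norm topology of matrices. *)
Definition expmx (R : realType) (n : nat) (A : 'M[R]_n) : 'M[R]_n :=
  limn (series (fun k : nat => (k`!%:R)^-1 *: A ^+ k)).

Definition cross (R : realType) (w x : 'cV[R]_3) : 'cV[R]_3 :=
  \col_(i < 3) (w (ordS i) 0 * x (ord_pred i) 0 - w (ord_pred i) 0 * x (ordS i) 0).

(* The matrix of the linear map x |-> w × x: see hatE. *)
Definition hat (R : realType) (w : 'cV[R]_3) : 'M[R]_3 :=
  \matrix_(i < 3, j < 3) cross w (delta_mx j 0) i 0.

(* Pairs theta = (w, v) stand for elements of se(3): see se3_mxP. *)
Definition se3_mx (R : realType) (theta : 'cV[R]_3 * 'cV[R]_3) : 'M[R]_4 :=
  block_mx (hat theta.1) theta.2 (0 : 'rV[R]_3) (0 : 'M[R]_1).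

Definition se3_norm (R : realType) (theta : 'cV[R]_3 * 'cV[R]_3) : R :=
  Num.sqrt (norm2 theta.1 ^+ 2 + norm2 theta.2 ^+ 2).

Lemma ordS3 :
  (ordS (@Ordinal 3 0 isT) = @Ordinal 3 1 isT) *
  (ordS (@Ordinal 3 1 isT) = @Ordinal 3 2 isT) *
  (ordS (@Ordinal 3 2 isT) = @Ordinal 3 0 isT).
Proof. by split; first split; apply/val_inj. Qed.

Lemma ord_pred3 :
  (ord_pred (@Ordinal 3 0 isT) = @Ordinal 3 2 isT) *
  (ord_pred (@Ordinal 3 1 isT) = @Ordinal 3 0 isT) *
  (ord_pred (@Ordinal 3 2 isT) = @Ordinal 3 1 isT).
Proof. by split; first split; apply/val_inj. Qed.

Lemma ord3P (P : 'I_3 -> Prop) :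
  P (@Ordinal 3 0 isT) -> P (@Ordinal 3 1 isT) -> P (@Ordinal 3 2 isT) ->
  forall i, P i.
Proof.
move=> p0 p1 p2 [[|[|[|//]]] Hi].
- by rewrite (_ : Ordinal Hi = Ordinal (isT : (0 < 3)%N)) //; apply/val_inj.
- by rewrite (_ : Ordinal Hi = Ordinal (isT : (1 < 3)%N)) //; apply/val_inj.
- by rewrite (_ : Ordinal Hi = Ordinal (isT : (2 < 3)%N)) //; apply/val_inj.
Qed.

Lemma crossE (R : realType) (w x : 'cV[R]_3) :
  let i0 : 'I_3 := @Ordinal 3 0 isT in
  let i1 : 'I_3 := @Ordinal 3 1 isT in
  let i2 : 'I_3 := @Ordinal 3 2 isT in
  [/\ cross w x i0 0 = w i1 0 * x i2 0 - w i2 0 * x i1 0,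
      cross w x i1 0 = w i2 0 * x i0 0 - w i0 0 * x i2 0 &
      cross w x i2 0 = w i0 0 * x i1 0 - w i1 0 * x i0 0].
Proof.
by move=> i0 i1 i2; split; rewrite mxE !(ordS3, ord_pred3).
Qed.

Lemma hatE (R : realType) (w x : 'cV[R]_3) : hat w *m x = cross w x.
Proof.
apply/colP => i; rewrite mxE.
under eq_bigr => j _ do rewrite !mxE !andbT mulrBl.
rewrite sumrB mxE; congr (_ - _).
- rewrite (bigD1 (ord_pred i)) //= eqxx mulr1 big1 ?addr0 // => j.
  by rewrite eq_sym => /negbTE ->; rewrite mulr0 mul0r.
- rewrite (bigD1 (ordS i)) //= eqxx mulr1 big1 ?addr0 // => j.
  by rewrite eq_sym => /negbTE ->; rewrite mulr0 mul0r.
Qed.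

Lemma se3_mxP (R : realType) (A : 'M[R]_4) :
  (exists theta, A = se3_mx theta) <->
  (exists (Om : 'M[R]_3) (v : 'cV[R]_3),
     Om^T = - Om /\ A = block_mx Om v (0 : 'rV[R]_3) (0 : 'M[R]_1)).
Proof.
split=> [[[w v] ->]|[Om [v [Omskew ->]]]].
  exists (hat w), v; split=> //; apply/matrixP.
  by apply: ord3P; apply: ord3P; rewrite !mxE !(ordS3, ord_pred3) /=; ring.
have sk i j : Om i j = - Om j i.
  by have /matrixP/(_ j i) := Omskew; rewrite !mxE.
have sk0 i : Om i i = 0.
  by have /eqP := sk i i; rewrite -addr_eq0 -mulr2n mulrn_eq0 => /eqP.
exists (\col_i Om (ord_pred i) (ordS i), v); rewrite /se3_mx /=.
apply: (congr1 (fun M : 'M[R]_3 => block_mx M v (0 : 'rV[R]_3) (0 : 'M[R]_1))).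
apply/matrixP.
by apply: ord3P; apply: ord3P; rewrite !mxE ?sk0 !(ordS3, ord_pred3) /= ?mulr0 ?mulr1
  ?subr0 ?sub0r //; rewrite ?oppr0 // -?sk.
Qed.

(* Main.v *)
(* Put A = se3_mx (w, v) and t = |w|.  Since w × (w × (w × p)) = - t^2 (w × p),
   we have A^4 = - t^2 A^2, so the exponential series collapses to
   1 + A + a A^2 + b A^3 with a = (1 - cos t) / t^2 and b = (t - sin t) / t^3
   (a = 1/2, b = 1/6 when t = 0, where A^2 = 0).  It maps (p, s) to
   (q, s) + (s u, 0), where q = p + (1 - b t^2) w × p + a w × (w × p) and
   u = v + a w × v + b w × (w × v).  Then |q| = |p|, by cos^2 + sin^2 = 1, and
   |u| <= |v|, by 2 - 2 cos t <= t^2; the triangle inequality concludes. *)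
Require Import Defs.
From mathcomp Require Import all_boot all_order all_algebra.
From mathcomp Require Import all_classical all_reals all_analysis.
From mathcomp Require Import ring lra.

Import Order.TTheory GRing.Theory Num.Theory.
Import numFieldNormedType.Exports.

Local Open Scope ring_scope.

(** * Trigonometric inequalities *)

Section TrigonometricBounds.
Variable R : realType.
Implicit Types t u : R.

Lemma sqr_sin_le u : 0 < u -> sin u ^+ 2 <= u ^+ 2.
Proof.
move=> u_gt0.
have [c _] : exists2 c, c \in `]0, u[%R & sin u - sin 0 = cos c * (u - 0).
  apply: MVT => //.
  by apply: continuous_subspaceT => x; exact: continuous_sin.
rewrite sin0 !subr0 => ->; rewrite exprMn ler_piMl ?sqr_ge0 //.
Qed.

(** By the half-angle formula, 2 - 2 cos t = 4 sin^2 (t / 2), which is at most t^2. *)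
Lemma cos_ge_quadratic t : 0 < t -> 2 - t ^+ 2 <= 2 * cos t.
Proof.
move=> t_gt0; have u_gt0 : 0 < t / 2 by rewrite divr_gt0.
have := sqr_sin_le _ u_gt0.
have -> : cos t = cos (t / 2 *+ 2) by rewrite -mulr_natr divfK.
rewrite cos_mulr2n cos2sin2; lra.
Qed.

End TrigonometricBounds.

(** * Euclidean norm and spectral norm *)

Section Norm2.
Variable R : realType.

Lemma norm2_ge0 n (x : 'cV[R]_n) : 0 <= norm2 x.
Proof. exact: sqrtr_ge0. Qed.

Lemma norm2_sqr n (x : 'cV[R]_n) : norm2 x ^+ 2 = \sum_i x i 0 ^+ 2.
Proof. by rewrite sqr_sqrtr // sumr_ge0 // => i _; exact: sqr_ge0. Qed.

Lemma norm2_eq0 n (x : 'cV[R]_n) : norm2 x = 0 -> x = 0.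
Proof.
move=> x0; have /eqP := norm2_sqr _ x; rewrite x0 expr0n /= eq_sym.
rewrite psumr_eq0 => [/allP xi0|i _]; last exact: sqr_ge0.
apply/colP => i; rewrite mxE; apply/eqP; rewrite -sqrf_eq0.
exact: (xi0 i (mem_index_enum i)).
Qed.

Lemma norm2Z n (k : R) (x : 'cV[R]_n) : norm2 (k *: x) = `|k| * norm2 x.
Proof.
rewrite /norm2 -sqrtr_sqr -sqrtrM ?sqr_ge0 // mulr_sumr; congr Num.sqrt.
by apply: eq_bigr => i _; rewrite mxE exprMn.
Qed.

Lemma norm2_col_mx m n (x : 'cV[R]_m) (y : 'cV[R]_n) :
  norm2 (col_mx x y) ^+ 2 = norm2 x ^+ 2 + norm2 y ^+ 2.
Proof.
rewrite !norm2_sqr big_split_ord /=.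
by congr (_ + _); apply: eq_bigr => i _; rewrite ?col_mxEu ?col_mxEd.
Qed.

(* Expanding [0 <= || |y| x - |x| y ||^2] and dividing by [|x| |y|]. *)
Lemma Cauchy_Schwarz_norm2 n (x y : 'cV[R]_n) :
  \sum_i x i 0 * y i 0 <= norm2 x * norm2 y.
Proof.
have [x0|x_neq0] := eqVneq (norm2 x) 0.
  by rewrite x0 mul0r (norm2_eq0 _ _ x0) big1 // => i _; rewrite mxE mul0r.
have [y0|y_neq0] := eqVneq (norm2 y) 0.
  by rewrite y0 mulr0 (norm2_eq0 _ _ y0) big1 // => i _; rewrite mxE mulr0.
have xy_gt0 : 0 < norm2 x * norm2 y.
  by rewrite mulr_gt0 // lt_def norm2_ge0 ?x_neq0 ?y_neq0.
have : 0 <= \sum_i (norm2 y * x i 0 - norm2 x * y i 0) ^+ 2.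
  by apply: sumr_ge0 => i _; exact: sqr_ge0.
rewrite (eq_bigr (fun i => norm2 y ^+ 2 * x i 0 ^+ 2
  + (- 2 * (norm2 x * norm2 y)) * (x i 0 * y i 0) + norm2 x ^+ 2 * y i 0 ^+ 2));
  last by move=> i _; ring.
rewrite !big_split /= -!mulr_sumr -!norm2_sqr => expanded.
rewrite -(ler_pM2l xy_gt0); nra.
Qed.

Lemma ler_norm2D n (x y : 'cV[R]_n) : norm2 (x + y) <= norm2 x + norm2 y.
Proof.
rewrite -(ler_pXn2r (n := 2)) ?nnegrE ?addr_ge0 ?norm2_ge0 //.
have CS := Cauchy_Schwarz_norm2 _ x y.
rewrite [leLHS]norm2_sqr; under [leLHS]eq_bigr => i _ do rewrite mxE sqrrD.
rewrite !big_split /= -!norm2_sqr.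
rewrite sqrrD; set s := \sum_i _ in CS *; lra.
Qed.

Lemma opnorm_le n (A : 'M[R]_n.+1) (c : R) :
  (forall x, norm2 x = 1 -> norm2 (A *m x) <= c) -> opnorm A <= c.
Proof.
move=> Ac; apply: ge_sup => [|_ [x x1 <-]]; last exact: Ac.
(* Bounding a supremum requires a nonempty set; the first basis vector is a unit vector, available
   in size [n.+1]. *)
exists (norm2 (A *m delta_mx 0 0)), (delta_mx 0 0) => //=.
rewrite /norm2 (bigD1 0) //= big1 => [|i /negbTE i0]; rewrite !mxE ?i0.
  by rewrite eqxx expr1n addr0 sqrtr1.
by rewrite expr0n.
Qed.

End Norm2.

(** * Closed forms of the exponential series *)

Section ExpQuartic.
Variables (R : realType) (n : nat) (A : 'M[R]_n.+1).

Lemma expmx_square_zero : A ^+ 2 = 0 -> expmx A = 1 + A.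
Proof.
move=> A2; apply: cvg_lim => //.
rewrite -(cvg_shiftn 2); apply: cvg_near_cst; near=> m.
rewrite /series /= addn2 big_nat_recl // big_nat_recl // big1.
  by rewrite expr0 expr1 invr1 !scale1r addr0.
by move=> i _; rewrite -addn2 exprD A2 mulr0 scaler0.
Unshelve. all: by end_near. Qed.

Variable t : R.
Hypothesis t_neq0 : t != 0.
Hypothesis A4 : A ^+ 4 = - t ^+ 2 *: A ^+ 2.

Lemma expr_quartic j :
  (A ^+ j.*2.+2 = (- t ^+ 2) ^+ j *: A ^+ 2) *
  (A ^+ j.*2.+3 = (- t ^+ 2) ^+ j *: A ^+ 3).
Proof.
have even k : A ^+ k.*2.+2 = (- t ^+ 2) ^+ k *: A ^+ 2.
  elim: k => [|k IH]; first by rewrite scale1r.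
  by rewrite doubleS -[in LHS]addn2 exprD IH -scalerAl -exprD A4 scalerA -exprSr.
by split=> //; rewrite exprS even -scalerAr -exprS.
Qed.

(** Even powers of [A] reduce to [A ^+ 2] and odd ones to [A ^+ 3], with alternating signs. One
    formula covers both parities since [cos_coeff] vanishes at odd indices and [sin_coeff] at even
    ones. *)
Lemma expmx_term k : (2 <= k)%N ->
  (k`!%:R)^-1 *: A ^+ k
  = - (cos_coeff t k *: (t ^- 2 *: A ^+ 2) + sin_coeff t k *: (t ^- 3 *: A ^+ 3)).
Proof.
have pow j : (- t ^+ 2) ^+ j = (-1) ^+ j * t ^+ j.*2.
  by rewrite [LHS]exprNn -exprM mul2n.
rewrite -(odd_double_half k); case: (k./2) => [|j]; first by case: (odd k).
rewrite doubleS; case: (odd k) => _; rewrite ?add0n ?add1n.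
  rewrite (expr_quartic j).2 pow -!doubleS cos_coeff_odd scale0r add0r.
  rewrite -sin_coeff'E /sin_coeff' !scalerA -scaleNr; congr (_ *: _).
  rewrite -exprnP doubleS !exprS; field.
  by rewrite t_neq0 pnatr_eq0 -lt0n fact_gt0.
rewrite (expr_quartic j).1 pow -!doubleS sin_coeff_even scale0r addr0.
rewrite -cos_coeff'E /cos_coeff' !scalerA -scaleNr; congr (_ *: _).
rewrite -exprnP doubleS !exprS; field.
by rewrite t_neq0 pnatr_eq0 -lt0n fact_gt0.
Qed.

Lemma expmx_quartic :
  expmx A = 1 + A + ((1 - cos t) / t ^+ 2) *: A ^+ 2
                  + ((t - sin t) / t ^+ 3) *: A ^+ 3.
Proof.
set B := t ^- 2 *: A ^+ 2; set C := t ^- 3 *: A ^+ 3.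
have -> : 1 + A + ((1 - cos t) / t ^+ 2) *: A ^+ 2
                + ((t - sin t) / t ^+ 3) *: A ^+ 3
        = (1 + A + B + t *: C) - (cos t *: B + sin t *: C).
  rewrite -!scalerA -/B -/C !scalerBl scale1r opprD [RHS]addrACA.
  by rewrite -[_ + B - _]addrA.
apply: cvg_lim => //; rewrite -(cvg_shiftn 2).
(* [expmx_term] starts at index 2, so the terms 1 and [t] at indices 0 and 1 of the cosine and sine
   series must be compensated: hence [B + t *: C]. *)
have -> : (fun m => series (fun k => (k`!%:R)^-1 *: A ^+ k) (m + 2)%N)
  = (fun m => (1 + A + B + t *: C)
     - (series (cos_coeff t) (m + 2)%N *: B + series (sin_coeff t) (m + 2)%N *: C)).
  apply/funext => m; rewrite /series /= addn2 !(big_nat_recl m.+1) // !(big_nat_recl m) //.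
  under eq_bigr => i _ do rewrite expmx_term //.
  rewrite sumrN big_split /= -!scaler_suml !scalerDl.
  rewrite [cos_coeff t 0](_ : _ = 1); last by rewrite /cos_coeff /= divr1 !mul1r.
  rewrite [cos_coeff t 1](_ : _ = 0); last by rewrite /cos_coeff /= !mul0r.
  rewrite [sin_coeff t 0](_ : _ = 0); last by rewrite /sin_coeff /= !mul0r.
  rewrite [sin_coeff t 1](_ : _ = t); last by rewrite /sin_coeff /= divr1 !mul1r.
  rewrite expr0 expr1 invr1 !scale1r !scale0r !add0r.
  set X := _ *: B; set Y := _ *: C; set Z := t *: C.
  rewrite [B + X + _]addrACA -[_ + B + Z]addrA [- (B + Z + _)]opprD.
  by rewrite [RHS]addrA addrK addrA.
apply: cvgB; first exact: cvg_cst.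
apply: cvgD; apply: cvgZr_tmp; rewrite (cvg_shiftn 2 (series _)).
  (* Unlocked, [cos t] is the limit of this very series, so convergence suffices; likewise for
     [sin t]. *)
  by rewrite unlock; exact: is_cvg_series_cos_coeff.
by rewrite unlock; exact: is_cvg_series_sin_coeff.
Qed.

End ExpQuartic.

(** * Action of se(3) on vectors (p, s) *)

Section Se3.
Variable R : realType.
Implicit Types w v p : 'cV[R]_3.

Lemma sum_ord3 (f : 'I_3 -> R) :
  \sum_i f i = f (@Ordinal 3 0 isT) + f (@Ordinal 3 1 isT) + f (@Ordinal 3 2 isT).
Proof.
rewrite !big_ord_recl big_ord0 addr0 addrA.
by congr (f _ + f _ + f _); apply/val_inj.
Qed.

Lemma cross_triple w p :
  cross w (cross w (cross w p)) = - norm2 w ^+ 2 *: cross w p.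
Proof.
rewrite norm2_sqr sum_ord3; apply/colP.
by apply: ord3P; rewrite !mxE !(ordS3, ord_pred3); ring.
Qed.

(** The vector w × p is orthogonal to p and to w × (w × p); moreover p · (w × (w × p)) = - |w × p|^2
    and |w × (w × p)| = |w| |w × p|. *)
Lemma norm2_quadratic_cross w p (a b : R) :
  norm2 (p + a *: cross w p + b *: cross w (cross w p)) ^+ 2
  = norm2 p ^+ 2
    + (a ^+ 2 + b ^+ 2 * norm2 w ^+ 2 - 2 * b) * norm2 (cross w p) ^+ 2.
Proof.
by rewrite !norm2_sqr !sum_ord3 !mxE !(ordS3, ord_pred3); ring.
Qed.

Lemma crossDr w p v : cross w (p + v) = cross w p + cross w v.
Proof. by rewrite -!hatE mulmxDr. Qed.

Lemma crossZr w (k : R) p : cross w (k *: p) = k *: cross w p.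
Proof. by rewrite -!hatE -scalemxAr. Qed.

Lemma norm2_col_mx31 p (s : 'cV[R]_1) :
  norm2 (col_mx p s : 'cV[R]_4) ^+ 2 = norm2 p ^+ 2 + s 0 0 ^+ 2.
Proof.
have <- : norm2 s ^+ 2 = s 0 0 ^+ 2 by rewrite norm2_sqr big_ord1.
exact: (norm2_col_mx _ 3 1).
Qed.

Lemma norm2_col_mx0 p : norm2 (col_mx p 0 : 'cV[R]_4) = norm2 p.
Proof.
apply/eqP; rewrite -(eqrXn2 (n := 2)) ?norm2_ge0 // norm2_col_mx31.
by rewrite mxE expr0n addr0.
Qed.

Lemma scale_col_mx0 (k : R) p :
  k *: (col_mx p 0 : 'cV[R]_4) = col_mx (k *: p) (0 : 'cV_1).
Proof. by have := scale_col_mx k p (0 : 'cV_1); rewrite scaler0. Qed.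

Lemma add_col_mx0 p v (s : 'cV[R]_1) :
  (col_mx p s : 'cV[R]_4) + col_mx v 0 = col_mx (p + v) s.
Proof. by have := add_col_mx p s v 0; rewrite addr0. Qed.

Lemma mul_se3_mx w v p (s : 'cV[R]_1) :
  se3_mx (w, v) *m col_mx p s = col_mx (cross w p + s 0 0 *: v) 0.
Proof.
apply: etrans (mul_block_col (hat w) v 0 0 p s) _.
rewrite hatE !mul0mx addr0; congr col_mx; congr (_ + _).
by rewrite [s]mx11_scalar mul_mx_scalar mxE eqxx mulr1n.
Qed.

(** The first application annihilates the last coordinate, so every later one acts as [cross w]
    alone. *)
Lemma expr_mul_se3_mx k w v p (s : 'cV[R]_1) :
  se3_mx (w, v) ^+ k.+1 *m col_mx p s
  = col_mx (iter k (cross w) (cross w p + s 0 0 *: v)) 0.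
Proof.
elim: k => [|k IH]; first by rewrite expr1 mul_se3_mx.
by rewrite exprS -mulmxE -mulmxA IH mul_se3_mx mxE scale0r addr0.
Qed.

Lemma mulmx_inj_col_mx (A B : 'M[R]_4) :
  (forall p (s : 'cV[R]_1), A *m col_mx p s = B *m col_mx p s) -> A = B.
Proof.
move=> AB; apply/matrixP => i j.
have := AB (usubmx (delta_mx j 0 : 'cV_(3 + 1))) (dsubmx (delta_mx j 0 : 'cV_(3 + 1))).
by rewrite vsubmxK -!colE => /colP/(_ i); rewrite !mxE.
Qed.

Lemma se3_mx_exp4 w v :
  se3_mx (w, v) ^+ 4 = - norm2 w ^+ 2 *: se3_mx (w, v) ^+ 2.
Proof.
apply: mulmx_inj_col_mx => p s; rewrite -scalemxAl !expr_mul_se3_mx /=.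
by rewrite cross_triple scale_col_mx0.
Qed.

(** Through [norm2_quadratic_cross], the equation makes p |-> q an isometry and the inequality makes
    v |-> u a contraction. *)
Lemma expmx_se3 w v : exists a b : R,
  [/\ expmx (se3_mx (w, v))
      = 1 + se3_mx (w, v) + a *: se3_mx (w, v) ^+ 2 + b *: se3_mx (w, v) ^+ 3,
      (1 - b * norm2 w ^+ 2) ^+ 2 + a ^+ 2 * norm2 w ^+ 2 - 2 * a = 0
    & a ^+ 2 + b ^+ 2 * norm2 w ^+ 2 - 2 * b <= 0].
Proof.
set A := se3_mx (w, v); set t := norm2 w.
have [t0|t_neq0] := eqVneq t 0.
  have A2 : A ^+ 2 = 0.
    apply: mulmx_inj_col_mx => p s; rewrite mul0mx expr_mul_se3_mx /= (norm2_eq0 _ _ _ t0).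
    rewrite (_ : cross 0 _ = 0) ?col_mx0 //.
    by apply/colP => i; rewrite !mxE !mul0r subrr.
  (* As [A ^+ 2 = 0], any [a] and [b] fit the series; the equation forces [a = 1 / 2], and the
     inequality then only asks for [b >= 1 / 8]. *)
  exists (1 / 2), (1 / 6); split; last 2 first; rewrite ?t0.
  - by field.
  - lra.
  - by rewrite [A ^+ 3]exprSr A2 mul0r !scaler0 !addr0 expmx_square_zero.
have t_gt0 : 0 < t by rewrite lt_def t_neq0 norm2_ge0.
exists ((1 - cos t) / t ^+ 2), ((t - sin t) / t ^+ 3); split.
- exact/expmx_quartic/se3_mx_exp4.
(* Here [1 - b * t ^+ 2] is sin t / t. *)
- transitivity ((cos t ^+ 2 + sin t ^+ 2 - 1) / t ^+ 2); first by field.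
  by rewrite cos2Dsin2 subrr mul0r.
- have -> : ((1 - cos t) / t ^+ 2) ^+ 2 + ((t - sin t) / t ^+ 3) ^+ 2 * t ^+ 2
            - 2 * ((t - sin t) / t ^+ 3)
          = (cos t ^+ 2 + sin t ^+ 2 + 1 - 2 * cos t - t ^+ 2) / t ^+ 4 by field.
  rewrite cos2Dsin2 mulr_le0_ge0 // ?invr_ge0 ?exprn_ge0 // ?(ltW t_gt0) //.
  have := cos_ge_quadratic _ _ t_gt0; lra.
Qed.

End Se3.

(** * The bound on unit vectors *)

Theorem lemma3p1 (R : realType) (r : R) (theta : 'cV[R]_3 * 'cV[R]_3)
    (r_ge0 : 0 <= r) (theta_le : se3_norm theta <= r) :
  opnorm (expmx (se3_mx theta)) <= 1 + r.
Proof.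
case: theta theta_le => w v theta_le.
have v_le : norm2 v <= r.
  apply: le_trans theta_le; rewrite -[norm2 v]ger0_norm ?norm2_ge0 // -sqrtr_sqr.
  by rewrite ler_wsqrtr // lerDr sqr_ge0.
have [a [b [-> rot trans]]] := expmx_se3 _ w v.
apply: opnorm_le => x; have [p [s ->]] : 
    exists (p : 'cV[R]_3) (s : 'cV[R]_1), x = col_mx p s.
  by exists (usubmx (x : 'cV_(3 + 1))), (dsubmx (x : 'cV_(3 + 1))); rewrite vsubmxK.
move=> ps1.
have ps_sqr : norm2 p ^+ 2 + s 0 0 ^+ 2 = 1.
  by rewrite -[RHS](expr1n _ 2) -ps1 norm2_col_mx31.
have s_le1 : `|s 0 0| <= 1.
  by rewrite -(ler_pXn2r (n := 2)) ?nnegrE // real_normK ?num_real // expr1n -ps_sqr lerDr sqr_ge0.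
set q := p + (1 - b * norm2 w ^+ 2) *: cross w p + a *: cross w (cross w p).
set u := v + a *: cross w v + b *: cross w (cross w v).
(* By [cross_triple], the cubic term in p folds into the coefficient of [cross w p], giving
   [1 - b * norm2 w ^+ 2]. *)
have -> : (1 + se3_mx (w, v) + a *: se3_mx (w, v) ^+ 2 + b *: se3_mx (w, v) ^+ 3)
  *m col_mx p s = col_mx q s + col_mx (s 0 0 *: u) 0.
  rewrite !mulmxDl mul1mx -!scalemxAl !expr_mul_se3_mx mul_se3_mx /=.
  rewrite !scale_col_mx0 !add_col_mx0.
  apply: (congr1 (fun y : 'cV[R]_3 => col_mx y s)).
  rewrite !(crossDr, crossZr) cross_triple /q /u.
  by apply/colP => i; rewrite !mxE; ring.
have q_norm : norm2 q = norm2 p.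
  apply/eqP; rewrite -(eqrXn2 (n := 2)) ?norm2_ge0 // norm2_quadratic_cross.
  by rewrite rot mul0r addr0.
have u_le : norm2 u <= norm2 v.
  rewrite -(ler_pXn2r (n := 2)) ?nnegrE ?norm2_ge0 // norm2_quadratic_cross.
  by rewrite gerDl mulr_le0_ge0 ?sqr_ge0.
(* The summand (q, s) has the norm of (p, s), namely 1; the other has norm |s| |u|, at most [r]. *)
apply: le_trans (ler_norm2D _ _ _ _) _; apply: lerD.
  rewrite -(ler_pXn2r (n := 2)) ?nnegrE ?norm2_ge0 // norm2_col_mx31.
  by rewrite q_norm ps_sqr expr1n.
rewrite norm2_col_mx0 norm2Z -[r]mul1r ler_pM ?norm2_ge0 //.
exact: le_trans u_le v_le.
Qed.
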